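(* Let $k$ be an algebraically closed field, let $m\ge 2$ and $n\ge 1$ be integers, and let $R=k[X_0,\ldots,X_m]$ be the standard graded polynomial ring. Let $I$ be a homogeneous ideal of $R$ generated by a minimal generating set of homogeneous polynomials $\mathbf f:=f_0,\ldots,f_n$ of the same degree $d$, with $\gcd(f_0,\ldots,f_n)=1$. Assume that the rational map $\phi=(f_0:\cdots:f_n):\mathbb P^m_k\dashrightarrow\mathbb P^n_k$ is generically finite onto its image, and that $I_3(J(\mathbf f))\neq 0$, where $I_3(J(\mathbf f))$ is the ideal of $R$ generated by the $3\times 3$ minors of the Jacobian matrix $J(\mathbf f)$. Let $F$ be the greatest common divisor of the generators (the $3\times3$ minors) of $I_3(J(\mathbf f))$. For each $y\in\mathcal Y_{m-1}$ let $h_y\in R$ be a homogeneous polynomial defining the unmixed $(m-1)$-dimensional part of the fiber $\pi^{-1}(y)\subset\mathbb P^m_k$, and let $h_y=h_{y,1}^{e_{y,1}}\cdots h_{y,r_y}^{e_{y,r_y}}$ be its irreducible factorization in $R$ (with the $h_{y,i}$ irreducible and pairwise non-associate, $e_{y,i}\ge 1$). Then $$\sum_{y \in \mathcal Y_{m-1}}\deg(h_y)\leq \sum_{y \in \mathcal Y_{m-1}}\sum_{i=1}^{r_y}(2e_{y,i}-1)\deg(h_{y,i})\leq \deg(F)\leq 3(d-1).$$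
   Context: The Jacobian matrix of $\mathbf f=f_0,\ldots,f_n$ is the $(n+1)\times(m+1)$ matrix $J(\mathbf f)=(\partial f_i/\partial X_j)_{0\le i\le n,\,0\le j\le m}$. ''$\phi$ is generically finite onto its image'' means that the closed image of $\phi$ in $\mathbb P^n_k$ has dimension $m$. Let $B=k[T_0,\ldots,T_n]$ be the homogeneous coordinate ring of $\mathbb P^n_k$ and $\mathcal R_I=\bigoplus_{s\ge 0}I^s(sd)$ the Rees algebra of $I$, a bigraded quotient of $R[T_0,\ldots,T_n]$ via $T_i\mapsto f_i$ (with $f_i$ placed in Rees degree $1$). Let $\Gamma\subset\mathbb P^m_k\times\mathbb P^n_k$ be the subscheme defined by $\mathcal R_I$; it is the Zariski closure of the graph of $\phi$. Let $\pi:\Gamma\to\mathbb P^n_k$ be the restriction of the second projection. For a closed point $y\in\mathbb P^n_k$ with residue field $k(y)\simeq k$, the fiber is the scheme-theoretic fiber $\pi^{-1}(y)=\mathrm{Proj}(\mathcal R_I\otimes_B k(y))$, viewed as a subscheme of $\mathbb P^m_{k(y)}\simeq\mathbb P^m_k$. Set $\mathcal Y_{m-1}=\{y\in\mathbb P^n_k \text{ closed point}\mid \dim\pi^{-1}(y)=m-1\}$. Under the hypotheses above this is a finite set. For $y\in\mathcal Y_{m-1}$, the unmixed part of $\pi^{-1}(y)$ of maximal dimension $m-1$ (the subscheme defined by the intersection of the primary components of dimension $m-1$ of the homogeneous ideal of $\pi^{-1}(y)$) is a hypersurface, because $R$ is factorial; $h_y\in R$ denotes its defining homogeneous polynomial (unique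 up to a nonzero scalar). *)

(* Defs.v *)
From HB Require Import structures.
From mathcomp Require Import all_boot all_order all_algebra finmap.
From mathcomp Require Import mpoly.

Set Implicit Arguments.
Unset Strict Implicit.
Unset Printing Implicit Defensive.

Import GRing.Theory.
Local Open Scope ring_scope.

Section Ideals.
Variable R : comNzRingType.
Implicit Types (J P Q S : R -> Prop) (p q g : R).

Definition is_ideal J : Prop :=
  [/\ J 0, forall p q, J p -> J q -> J (p + q)
    & forall p q, J q -> J (p * q)].

Definition ideal_gen S p : Prop :=
  exists2 s : seq (R * R), (forall c, c \in s -> S c.2)
                         & p = \sum_(c <- s) c.1 * c.2.

Definition is_prime_ideal P : Prop :=
  [/\ is_ideal P, ~ P 1 & forall p q, P (p * q) -> P p \/ P q].

Definition radical J p : Prop := exists n : nat, J (p ^+ n).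

Definition is_primary_ideal Q : Prop :=
  [/\ is_ideal Q, ~ Q 1 & forall p q, Q (p * q) -> Q p \/ radical Q q].

Definition divides p q : Prop := exists c, q = c * p.

Definition is_gcd S g : Prop :=
  (forall p, S p -> divides g p) /\
  (forall c, (forall p, S p -> divides c p) -> divides c g).

End Ideals.

Section Factorization.
Variable R : idomainType.
Implicit Types p q : R.

Definition irreducible_elt p : Prop :=
  [/\ p != 0, p \isn't a GRing.unit
    & forall a b, p = a * b -> a \is a GRing.unit \/ b \is a GRing.unit].

Definition associate p q : Prop :=
  exists2 u, u \is a GRing.unit & p = u * q.

Definition is_factorization p (r : nat) (q : 'I_r -> R) (e : 'I_r -> nat)
    : Prop :=
  [/\ forall i, irreducible_elt (q i),
      forall i j, i != j -> ~ associate (q i) (q j),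
      forall i, (1 <= e i)%N
    & p = \prod_(i < r) q i ^+ e i].

End Factorization.

Section Minors.
Variable R : comNzRingType.

Definition is_minor (r p q : nat) (A : 'M[R]_(p, q)) (x : R) : Prop :=
  exists (a : 'I_r -> 'I_p) (b : 'I_r -> 'I_q),
    [/\ {homo a : i j / (i < j)%N}, {homo b : i j / (i < j)%N}
      & x = \det (mxsub a b A)].

Definition minors_ideal (r p q : nat) (A : 'M[R]_(p, q)) : R -> Prop :=
  ideal_gen (is_minor r A).

End Minors.

(* A closed subscheme of the projective space of dimension N is given by a     *)
(* homogeneous ideal J of k[X_0, ..., X_N], as Proj (k[X_0, ..., X_N] / J).    *)
Section Proj.
Variables (k : closedFieldType) (N : nat).
Local Notation S := {mpoly k[N.+1]}.
Implicit Types (J P : S -> Prop).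

Definition pdeg (p : S) : nat := (msize p).-1.

Definition homog_ideal J : Prop :=
  is_ideal J /\ forall p e, J p -> J (pihomog mdeg e p).

Definition proj_point J P : Prop :=
  [/\ homog_ideal P, is_prime_ideal P, forall p, J p -> P p
    & exists i, ~ P 'X_i].

(* Chains of r + 1 points under strict specialization, which correspond to     *)
(* chains of irreducible closed subsets of Proj.                               *)
Definition proj_chain J (r : nat) : Prop :=
  exists P : 'I_r.+1 -> S -> Prop,
    (forall i, proj_point J (P i)) /\
    (forall i j : 'I_r.+1, (i < j)%N ->
       (forall p, P i p -> P j p) /\ exists2 p, P j p & ~ P i p).

(* Krull dimension; the empty scheme has no dimension in nat. *)
Definition proj_dim J (r : nat) : Prop :=
  proj_chain J r /\ forall s, proj_chain J s -> (s <= r)%N.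

Definition is_primary_decomposition J (s : nat) (Q : 'I_s -> S -> Prop)
    : Prop :=
  [/\ forall i, homog_ideal (Q i) /\ is_primary_ideal (Q i),
      forall p, J p <-> forall i, Q i p,
      forall i j, i != j -> ~ (forall p, radical (Q i) p <-> radical (Q j) p)
    & forall i, exists2 p, (forall j, j != i -> Q j p) & ~ Q i p].

(* The intersection of the r-dimensional primary components of J is (h). When  *)
(* r is the dimension of Proj (S / J) these components are isolated, so the    *)
(* choice of the decomposition is irrelevant.                                  *)
Definition defines_unmixed_part J (r : nat) (h : S) : Prop :=
  (exists e : nat, h \is e.-homog) /\
  exists (s : nat) (Q : 'I_s -> S -> Prop),
    is_primary_decomposition J Q /\
    forall p, (forall i, proj_dim (Q i) r -> Q i p) <-> divides h p.

(* Closed points of the projective space over an algebraically closed field:   *)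
(* lines through the origin of the affine space of dimension N + 1.            *)
Definition pspace := {L : {vspace 'rV[k]_N.+1} | \dim L == 1%N}.

(* A choice of homogeneous coordinates. *)
Definition hcoord (y : pspace) : 'I_N.+1 -> k := vpick (val y) 0.

(* The homogeneous ideal of the Zariski closure of Z. *)
Definition vanishing_ideal (Z : pspace -> Prop) (g : S) : Prop :=
  forall y, Z y -> forall v, v \in val y -> g.@[v 0] = 0.

End Proj.

Section RationalMap.
Variables (k : closedFieldType) (m n : nat).
Local Notation R := {mpoly k[m.+1]}.
Variable f : 'I_n.+1 -> R.

Definition minimal_generators : Prop :=
  forall i, ~ ideal_gen (fun p => exists2 j, j != i & p = f j) (f i).

Definition jacobian : 'M[R]_(n.+1, m.+1) := \matrix_(i, j) mderiv j (f i).

Definition map_value (x : pspace k m) : 'rV[k]_n.+1 :=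
  \row_i (f i).@[hcoord x].

Definition map_image (y : pspace k n) : Prop :=
  exists2 x, map_value x != 0 & map_value x \in val y.

Definition generically_finite : Prop :=
  proj_dim (vanishing_ideal map_image) m.

(* The kernel of R[T_0, ..., T_n] -> R[t], T_i |-> f_i t, whose image is the   *)
(* Rees algebra R[I t] of the ideal I generated by f.                          *)
Definition rees_ideal (G : {mpoly R[n.+1]}) : Prop :=
  mmap (@polyC R) (fun i => (f i)%:P * 'X) G = 0.

(* Tensoring R[T_0, ..., T_n] / rees_ideal with k(y) specializes T to the      *)
(* coordinates of y; as rees_ideal is bihomogeneous, scaling the coordinates   *)
(* does not change the resulting ideal of R.                                   *)
Definition fiber_ideal (y : pspace k n) (p : R) : Prop :=
  exists2 G, rees_ideal G & p = G.@[fun i => (hcoord y i)%:MP].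

Definition in_Y (y : pspace k n) : Prop := proj_dim (fiber_ideal y) m.-1.

End RationalMap.

(* Main.v *)
(* Write v for the coordinates of a point y of Y. The equations                *)
(* f_b T_a - f_a T_b of the Rees algebra specialize to elements                *)
(* v_a f_b - v_b f_a of the fiber ideal, so h_y divides all of them; hence     *)
(* f_i = c_i f_a + h_y g_i for some a and scalars c_i. Let z be the product    *)
(* of the q ^ (e - 1) over the factors q ^ e of h_y. As z divides the partial  *)
(* derivatives of h_y, the Jacobian matrix is, modulo h_y, a sum of two        *)
(* matrices of rank one, the second of which is divisible by z. Hence h_y z,   *)
(* the product of the q ^ (2 e - 1), divides the 3 x 3 minors.                 *)
(* A common prime factor of h_y and h_y' with y <> y' would divide every f_i.  *)
(* By unique factorization the product over y of these polynomials thus        *)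
(* divides F. Each of them has positive degree, since the smallest prime of a  *)
(* chain of length m - 1 above the fiber ideal contains a primary component,   *)
(* which then has dimension m - 1; this also bounds the number of points y.    *)

Require Import Defs.
From HB Require Import structures.
From mathcomp Require Import all_boot all_order all_algebra finmap ring.
From mathcomp Require Import mpoly.
From Stdlib Require Import Classical.

Set Implicit Arguments.
Unset Strict Implicit.
Unset Printing Implicit Defensive.

Import GRing.Theory.
Local Open Scope ring_scope.

(** * Factorial rings *)

(** With [q ^ e] running over the factors of [h_y], let [D y] be the product of the [q ^ (2 e - 1)].
    The first inequality is [e <= 2 e - 1]. For the second, [D y] divides every 3 x 3 minor of the
    Jacobian matrix ([fiber_divisor_minor], by the expansion in [divides_det3]), and [D y], [D y']
    share no prime factor for distinct points, since such a factor would divide all [f_i]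
    ([fiber_divisor_common]). The polynomial ring being factorial ([factorial_mpoly]), the product
    of the [D y] over any finite set of points of Y divides F ([coprime_prod_divides]). As no [h_y]
    is constant ([unmixed_part_nonunit]), such a set has at most deg F elements, so Y is finite
    ([finite_of_bounded]). The third inequality holds because F divides a nonzero minor, which is
    homogeneous of degree 3 (d - 1). *)

Lemma ex_least (P : nat -> Prop) :
  (exists n, P n) -> exists2 n, P n & forall i, (i < n)%N -> ~ P i.
Proof.
move=> [n Pn]; apply: NNPP => H.
have: forall k i, (i < k)%N -> ~ P i.
  elim=> [|k IHk] // i; rewrite ltnS leq_eqVlt => /orP[/eqP->|]; last exact: IHk.
  by move=> Pk; apply: H; exists k.
by move=> /(_ n.+1 n (ltnSn n)).
Qed.

Section Divides.
Variable R : comNzRingType.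
Implicit Types p q r : R.

Lemma divides_refl p : divides p p.
Proof. by exists 1; rewrite mul1r. Qed.

Lemma divides_trans p q r : divides p q -> divides q r -> divides p r.
Proof. by move=> [a ->] [b ->]; exists (b * a); rewrite mulrA. Qed.

Lemma divides0 p : divides p 0.
Proof. by exists 0; rewrite mul0r. Qed.

Lemma dividesD p q r : divides p q -> divides p r -> divides p (q + r).
Proof. by move=> [a ->] [b ->]; exists (a + b); rewrite mulrDl. Qed.

Lemma dividesN p q : divides p q -> divides p (- q).
Proof. by move=> [a ->]; exists (- a); rewrite mulNr. Qed.

Lemma divides_mull p q r : divides p q -> divides p (r * q).
Proof. by move=> [a ->]; exists (r * a); rewrite mulrA. Qed.

Lemma divides_mulr p q r : divides p q -> divides p (q * r).
Proof. by rewrite mulrC; exact: divides_mull. Qed.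

Lemma divides_mul p q r s : divides p q -> divides r s -> divides (p * r) (q * s).
Proof. by move=> [a ->] [b ->]; exists (a * b); rewrite mulrACA. Qed.

Lemma divides_unit p q : divides p 1 -> divides p q.
Proof. by move=> p1; rewrite -(mulr1 q); exact: divides_mull. Qed.

Lemma divides_sum (I : eqType) (s : seq I) (P : pred I) (E : I -> R) p :
  (forall i, P i -> divides p (E i)) -> divides p (\sum_(i <- s | P i) E i).
Proof.
by move=> H; apply: (big_ind (divides p)) => //; [exact: divides0|exact: dividesD].
Qed.

Lemma divides_prod (I : Type) (s : seq I) (E G : I -> R) :
  (forall i, divides (E i) (G i)) ->
  divides (\prod_(i <- s) E i) (\prod_(i <- s) G i).
Proof.
move=> H; apply: (big_ind2 (@divides R)) => //; first exact: divides_refl.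
by move=> *; exact: divides_mul.
Qed.

Definition prime_elt p : Prop :=
  [/\ p != 0, ~ divides p 1
    & forall a b, divides p (a * b) -> divides p a \/ divides p b].

(** Asking for prime rather than irreducible factors builds uniqueness of factorization into its
    existence. *)
Definition factored p : Prop :=
  exists (u : R) (s : seq R), [/\ divides u 1, forall q, q \in s -> prime_elt q
    & p = u * \prod_(q <- s) q].

Definition factorial_ring : Prop := forall p, p != 0 -> factored p.

Lemma factored_unit u : divides u 1 -> factored u.
Proof. by move=> u1; exists u, [::]; rewrite big_nil mulr1. Qed.

Lemma factored_prime p : prime_elt p -> factored p.
Proof.
move=> pP; exists 1, [:: p]; split; first exact: divides_refl.
  by move=> q; rewrite inE => /eqP->.
by rewrite big_seq1 mul1r.
Qed.

Lemma factoredM p q : factored p -> factored q -> factored (p * q).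
Proof.
move=> [u [s [u1 sP ->]]] [v [t [v1 tP ->]]]; exists (u * v), (s ++ t); split.
- by rewrite -(mulr1 1); exact: divides_mul.
- by move=> x; rewrite mem_cat => /orP[/sP|/tP].
- by rewrite big_cat mulrACA.
Qed.

Lemma prime_divides_prod (s : seq R) p :
  prime_elt p -> divides p (\prod_(q <- s) q) -> exists2 q, q \in s & divides p q.
Proof.
move=> [_ pN1 pM]; elim: s => [|q s IHs]; first by rewrite big_nil.
rewrite big_cons => /pM[pq|/IHs[x xs px]].
  by exists q; rewrite ?mem_head.
by exists x; rewrite // inE xs orbT.
Qed.

Lemma prime_divides_bigprod (I : finType) (E : I -> R) p :
  prime_elt p -> divides p (\prod_i E i) -> exists i, divides p (E i).
Proof.
move=> pP; rewrite -(big_map E xpredT id) => /(prime_divides_prod pP).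
by move=> [q /mapP[i _ ->]]; exists i.
Qed.

Lemma prime_divides_exp p q n : prime_elt p -> divides p (q ^+ n) -> divides p q.
Proof.
move=> [_ pN1 pM]; elim: n => [|n IHn]; first by rewrite expr0.
by rewrite exprS => /pM[].
Qed.

End Divides.

Section DivideIdomain.
Variable R : idomainType.
Implicit Types p q r : R.

Lemma divides_cancel p q r : p != 0 -> divides (p * q) (p * r) -> divides q r.
Proof. by move=> p0 [a]; rewrite mulrCA => /(mulfI p0) ->; exists a. Qed.

Lemma prime_divides_prime p q : prime_elt p -> prime_elt q ->
  divides q p -> divides p q.
Proof.
move=> [p0 pN1 pM] [q0 qN1 qM] [a pE].
have: divides p (a * q) by rewrite -pE; exact: divides_refl.
move=> /pM[[b aE]|//]; case: qN1; exists b.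
by apply: (mulfI p0); rewrite mulr1 mulrCA [LHS]pE [in LHS]aE mulrA.
Qed.

Lemma factorial_prime_divisor p : factorial_ring R -> p != 0 -> ~ divides p 1 ->
  exists2 q, prime_elt q & divides q p.
Proof.
move=> fact p0 pN1; have [u [[|q s] [u1 sP pE]]] := fact p p0.
  by case: pN1; rewrite pE big_nil mulr1.
exists q; first by apply: sP; rewrite mem_head.
by rewrite pE big_cons mulrCA; apply: divides_mulr; exact: divides_refl.
Qed.

Definition coprime_elt p q : Prop :=
  forall x, prime_elt x -> divides x p -> ~ divides x q.

(** Induction on the prime factors of [p]: each divides [q * r] but not [q], hence divides [r], and
    can be cancelled. *)
Lemma coprime_divides_mul p q r : factorial_ring R -> p != 0 ->
  coprime_elt p q -> divides p (q * r) -> divides p r.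
Proof.
move=> fact p0; have [u [s [u1 sP ->]]] := fact p p0.
elim: s sP r => [|x s IHs] sP r.
  by rewrite big_nil mulr1 => _ _; exact: divides_unit.
have [x0 xN1 xM] : prime_elt x by apply: sP; rewrite mem_head.
rewrite big_cons mulrCA => cop dv.
have [||[c rE]] := xM q r.
- by apply: divides_trans dv; apply: divides_mulr; exact: divides_refl.
- move=> xq; case: (cop x _ _ xq) => //.
  by apply: divides_mulr; exact: divides_refl.
have {}dv : divides (u * \prod_(j <- s) j) (q * c).
  by apply: (divides_cancel x0); rewrite [x in divides _ x]mulrCA (mulrC x c) -rE.
rewrite rE (mulrC c); apply: divides_mul; first exact: divides_refl.
apply: IHs => //; first by move=> y ys; apply: sP; rewrite inE ys orbT.
by move=> y yP yd; apply: cop => //; exact: divides_mull.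
Qed.

Lemma coprime_prod_divides (I : eqType) (s : seq I) (E : I -> R) r :
  factorial_ring R -> uniq s -> (forall i, i \in s -> E i != 0) ->
  {in s &, forall i j, i != j -> coprime_elt (E i) (E j)} ->
  (forall i, i \in s -> divides (E i) r) -> divides (\prod_(i <- s) E i) r.
Proof.
move=> fact; elim: s r => [|i s IHs] r /=.
  by rewrite big_nil => *; exists r; rewrite mulr1.
move=> /andP[iNs us] E0 cop dv.
have [c rE] := dv i (mem_head _ _).
have Ei0 := E0 i (mem_head _ _).
rewrite big_cons rE (mulrC c); apply: divides_mul; first exact: divides_refl.
have ins j : j \in s -> j \in i :: s by rewrite inE orbC => ->.
apply: IHs => // [j /ins/E0 //|j l /ins js /ins ls|j js]; first exact: cop.
apply: (@coprime_divides_mul _ (E i)) => //; first exact/E0/ins.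
  apply: cop; rewrite ?mem_head ?ins //.
  by apply: contraNneq iNs => <-.
by rewrite mulrC -rE; exact/dv/ins.
Qed.

End DivideIdomain.

(** * Gauss's lemma: polynomials over a factorial ring form a factorial ring *)

Section Gauss.
Variable R : idomainType.
Implicit Types (p c : R) (f g h : {poly R}).

Lemma divides_polyC p f : divides p%:P f <-> forall i, divides p f`_i.
Proof.
split=> [[a ->] i|H].
  by rewrite coefMC; apply: divides_mull; exact: divides_refl.
suff: divides p%:P (\sum_(i < size f) (f`_i)%:P * 'X^i).
  by under eq_bigr do rewrite mul_polyC; rewrite -poly_def coefK.
apply: divides_sum => i _; apply: divides_mulr; have [a ->] := H i.
by exists a%:P; rewrite polyCM.
Qed.

Lemma divides_polyC1 p : divides p%:P 1 -> divides p 1.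
Proof. by move=> /divides_polyC/(_ 0%N); rewrite coef1. Qed.

(** If the first coefficients of [f] and [g] not divisible by [p] have indices [i] and [j], then the
    coefficient of index [i + j] of [f * g] is [f_i g_j] modulo [p]. *)
Lemma prime_polyC p : prime_elt p -> prime_elt p%:P.
Proof.
move=> [p0 pN1 pM]; split; first by rewrite polyC_eq0.
  by move=> /divides_polyC1.
move=> f g /divides_polyC dv.
apply: NNPP => /not_or_and[/divides_polyC fN /divides_polyC gN].
have [i fi leI] := ex_least (not_all_ex_not _ _ fN).
have [j gj leJ] := ex_least (not_all_ex_not _ _ gN).
case: (pM f`_i g`_j) => //.
have := dv (i + j)%N; rewrite coefM.
have ltI : (i < (i + j).+1)%N by rewrite ltnS leq_addr.
rewrite (bigD1 (Ordinal ltI)) //= addKn => dvs.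
set S := (X in divides p (_ + X)) in dvs.
rewrite -[X in divides p X](addrK S); apply: dividesD => //; apply: dividesN.
apply: divides_sum => l; rewrite -val_eqE /= neq_ltn => /orP[li|il].
  by apply: divides_mulr; apply: NNPP; exact: (leI _ li).
apply: divides_mull; apply: NNPP; apply: (leJ (_ - _)%N).
by rewrite ltn_subLR ?ltn_add2r // -ltnS.
Qed.

Hypothesis factR : factorial_ring R.

(* Gauss's lemma: the denominator c of a factorization over the fraction field *)
(* can be distributed over the two factors and cancelled.                      *)
Lemma gauss_split c f g h : c != 0 -> c%:P * f = g * h ->
  exists c1 c2 (g' h' : {poly R}), [/\ g = c1%:P * g', h = c2%:P * h' & f = g' * h'].
Proof.
move=> c0; have [u [s [[v uv] sP ->]]] := factR c0.
elim: s sP f g h => [|p s IHs] sP f g h.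
  rewrite big_nil mulr1 => E.
  have uv1 : v%:P * u%:P = 1 :> {poly R} by rewrite -polyCM -uv.
  exists u, 1, (v%:P * g), h; split; first by rewrite mulrA (mulrC u%:P) uv1 mul1r.
    by rewrite mul1r.
  by rewrite -mulrA -E mulrA uv1 mul1r.
have pP : prime_elt p by apply: sP; rewrite mem_head.
have P0 : p%:P != 0 by rewrite polyC_eq0; case: pP.
have {}sP q : q \in s -> prime_elt q by move=> qs; apply: sP; rewrite inE qs orbT.
rewrite big_cons mulrCA polyCM -mulrA => E.
have [_ _ pM] := prime_polyC pP.
case: (pM g h) => [|[a aE]|[a aE]].
- by rewrite -E; apply: divides_mulr; exact: divides_refl.
- move: E; rewrite aE (mulrC a) -mulrA => /(mulfI P0) /(IHs sP).
  move=> [c1 [c2 [g' [h' [-> -> ->]]]]]; exists (p * c1), c2, g', h'.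
  by rewrite polyCM mulrA.
- move: E; rewrite aE (mulrC a) [g * _]mulrCA => /(mulfI P0).
  move=> /(IHs sP).
  move=> [c1 [c2 [g' [h' [-> -> ->]]]]]; exists c1, (p * c2), g', h'.
  by rewrite polyCM mulrA.
Qed.

Lemma divides1_size f : divides f 1 -> size f = 1%N.
Proof.
move=> [a aE]; have : f \is a GRing.unit by apply/unitrPr; exists a; rewrite mulrC.
by rewrite poly_unitE => /andP[/eqP].
Qed.

(** The relation [%|] is divisibility up to a nonzero scalar, that is, over the fraction field,
    where gcds are available; [gauss_split] brings the conclusions back to [R]. *)
Lemma irreducible_prime_poly f : (1 < size f)%N ->
  (forall a b, f = a * b -> divides a 1 \/ divides b 1) -> prime_elt f.
Proof.
move=> szf irr.
have f0 : f != 0 by rewrite -size_poly_gt0 ltnW.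
have split_dvd g : (f %| g)%R -> divides f g.
  move=> /Pdiv.Idomain.dvdpP[[c q] /= c0]; rewrite -mul_polyC => E.
  have [c1 [c2 [q' [f' [qE fE ->]]]]] := gauss_split c0 E.
  case: (irr _ _ fE) => [[v vE]|/divides1_size f'1].
    exists (q' * v); rewrite [X in _ = _ * X]fE -mulrA; congr (_ * _).
    by rewrite mulrA -vE mul1r.
  have := size_polyMleq c2%:P f'; rewrite -fE f'1 addn1 /= => sz.
  by have := leq_trans szf (leq_trans sz (size_polyC_leq1 _)).
split=> //; first by move=> /divides1_size f1; rewrite f1 in szf.
move=> g h fgh.
have {}fgh : (f %| g * h)%R.
  by have [a ->] := fgh; rewrite Pdiv.Idomain.dvdp_mull.
have /Pdiv.Idomain.dvdpP[[c q] /= c0] := Pdiv.Idomain.dvdp_gcdl f g.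
rewrite -mul_polyC => E.
have [c1 [c2 [q' [d [qE dE fE]]]]] := gauss_split c0 E.
have c20 : c2 != 0.
  apply: contraTneq szf => c20; move: E => /eqP; rewrite dE c20 mul0r mulr0.
  by rewrite mulf_eq0 polyC_eq0 (negbTE c0) (negbTE f0).
(* Up to scalars [d] is the gcd of [f] and [g]: either it is associate to [f], so [f] divides [g],
   or it is constant and [f] divides [h] by coprimality. *)
case: (irr _ _ fE) => [[v vE]|/divides1_size d1]; [left|right]; apply: split_dvd.
  apply: Pdiv.Idomain.dvdp_trans (Pdiv.Idomain.dvdp_gcdr f g).
  have -> : gcdp f g = (c2%:P * v) * f by rewrite dE fE mulrA -[c2%:P * v * q']mulrA -vE mulr1.
  exact: Pdiv.Idomain.dvdp_mulIr.
rewrite -(@Pdiv.Idomain.Gauss_dvdpr _ _ g) //.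
by rewrite Pdiv.Idomain.coprimep_def dE size_Cmul // d1.
Qed.

(** Constant divisors of [f] divide its leading coefficient, so primes can be pulled out of [f] only
    finitely often; the induction is on the number of primes in that coefficient. *)
Lemma primitive_part f : f != 0 -> exists c g,
  [/\ c != 0, f = c%:P * g & forall a, divides a%:P g -> divides a 1].
Proof.
move=> f0; have [u [s [u1 sP]]] : factored (lead_coef f).
  by apply: factR; rewrite lead_coef_eq0.
elim: {s}(size s) {-2}s (erefl (size s)) sP f f0 => [|n IHn] s sn sP f f0 lf.
  exists 1, f; split; rewrite ?mul1r ?oner_neq0 // => a /divides_polyC da.
  apply: divides_trans u1.
  by have := da (size f).-1; rewrite -lead_coefE lf (size0nil sn) big_nil mulr1.
have [[p ps pf]|noP] := classic (exists2 p, p \in s & divides p%:P f).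
  have [p0 pN1 pM] := sP p ps; have [g gE] := pf.
  have g0 : g != 0 by apply: contraNneq f0 => g0; rewrite gE g0 mul0r.
  have [|||c [h [c0 hE hP]]] := IHn (rem p s) _ _ g g0 _.
  - by rewrite size_rem // sn.
  - by move=> q /mem_rem; exact: sP.
  - apply: (mulfI p0); rewrite mulrCA.
    have <- : \prod_(q <- s) q = p * \prod_(q <- rem p s) q.
      by rewrite (perm_big _ (perm_to_rem ps)) big_cons.
    by rewrite -lf gE lead_coefM lead_coefC mulrC.
  exists (p * c), h; rewrite mulf_neq0 // gE hE polyCM; split=> //.
  by rewrite mulrC mulrA.
exists 1, f; split; rewrite ?mul1r ?oner_neq0 // => a dvaf.
apply: NNPP => aN1.
have a0 : a != 0.
  apply: contraNneq f0 => a0; have [g ->] := dvaf.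
  by rewrite a0 mulr0.
have [q qP qa] := factorial_prime_divisor factR a0 aN1.
have qf : divides q%:P f.
  by apply: divides_trans dvaf; have [b ->] := qa; exists b%:P; rewrite polyCM.
have : divides q (u * \prod_(p <- s) p).
  by rewrite -lf lead_coefE; move/divides_polyC: qf; apply.
have [_ qN1 qM] := qP.
move=> /qM[qu|/(prime_divides_prod qP)[p ps qp]].
  by apply: qN1; exact: divides_trans u1.
apply: noP; exists p => //; apply: divides_trans qf.
have [b ->] := prime_divides_prime (sP p ps) qP qp.
by exists b%:P; rewrite polyCM.
Qed.

Lemma factored_polyC c : c != 0 -> factored c%:P.
Proof.
move=> c0; have [u [s [[v uv] sP ->]]] := factR c0.
exists u%:P, (map polyC s); split.
- by exists v%:P; rewrite -polyCM -uv.
- by move=> q /mapP[p /sP pP ->]; exact: prime_polyC.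
- by rewrite polyCM rmorph_prod big_map.
Qed.

(** The content factors in [R]. A primitive part that is not irreducible splits into two nonconstant
    factors, because its constant divisors are units, so both have smaller degree. *)
Lemma factorial_poly : factorial_ring {poly R}.
Proof.
move=> f; have [n] := ubnP (size f); elim: n f => // n IHn f szf f0.
have [c [g [c0 fE gP]]] := primitive_part f0.
rewrite fE; apply: factoredM; first exact: factored_polyC.
have g0 : g != 0 by apply: contraNneq f0 => g0; rewrite fE g0 mulr0.
have const_unit a b : g = a * b -> (size a <= 1)%N -> divides a 1.
  move=> gE /size1_polyC aE; have [|b' E] := gP a`_0.
    by rewrite -aE gE; apply: divides_mulr; exact: divides_refl.
  by exists b'%:P; rewrite aE -polyCM -E.
have [g1|g1] := leqP (size g) 1.
  by apply: factored_unit; apply: (const_unit _ 1); rewrite ?mulr1.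
have [irr|/not_all_ex_not[a /not_all_ex_not[b]]] :=
  classic (forall a b, g = a * b -> divides a 1 \/ divides b 1).
  exact/factored_prime/irreducible_prime_poly.
move=> nirr; have [gE /not_or_and[aN1 bN1]] := imply_to_and _ _ nirr.
have a0 : a != 0 by apply: contraNneq g0 => a0; rewrite gE a0 mul0r.
have b0 : b != 0 by apply: contraNneq g0 => b0; rewrite gE b0 mulr0.
have a1 : (1 < size a)%N by rewrite ltnNge; apply/negP => /(const_unit _ _ gE).
have b1 : (1 < size b)%N.
  by rewrite ltnNge; apply/negP => /(@const_unit _ a); rewrite mulrC => /(_ gE).
have := size_mul a0 b0; rewrite -gE.
move: szf; rewrite fE size_Cmul // ltnS => szg szab.
rewrite gE; apply: factoredM; apply: IHn => //; apply: leq_trans szg; rewrite szab.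
  by case: (size b) b1 => [|[|j]] // _; rewrite !addnS /= ltnS leq_addr.
by case: (size a) a1 => [|[|j]] // _; rewrite !addSn /= ltnS leq_addl.
Qed.

End Gauss.

Section Transfer.
Variables (S T : idomainType) (phi : {rmorphism S -> T}) (psi : {rmorphism T -> S}).
Hypotheses (phiK : cancel phi psi) (psiK : cancel psi phi).

Lemma divides_morph a b : divides a b -> divides (phi a) (phi b).
Proof. by move=> [c ->]; exists (phi c); rewrite rmorphM. Qed.

Lemma divides_morph_inv a b : divides (psi a) (psi b) -> divides a b.
Proof. by move=> [c E]; exists (phi c); rewrite -[b]psiK E rmorphM psiK. Qed.

Lemma factorial_isomorphic : factorial_ring S -> factorial_ring T.
Proof.
move=> factS x x0; have psi0 y : (psi y == 0) = (y == 0).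
  by rewrite -(inj_eq (can_inj psiK)) rmorph0.
have [|u [s [u1 sP xE]]] := factS (psi x); first by rewrite psi0.
exists (phi u), (map phi s); split.
- by rewrite -(rmorph1 phi); exact: divides_morph.
- move=> q /mapP[p /sP[p0 pN1 pM] ->]; split.
  + by rewrite -psi0 phiK.
  + rewrite -(rmorph1 phi) => pd; apply: pN1; rewrite -(phiK p) -(phiK 1).
    by move: pd => [c E]; exists (psi c); rewrite -rmorphM -E.
  + move=> a b [c E]; case: (pM (psi a) (psi b)).
    * by exists (psi c); rewrite -rmorphM E rmorphM phiK.
    * by rewrite -{1}(phiK p) => /divides_morph_inv; left.
    * by rewrite -{1}(phiK p) => /divides_morph_inv; right.
- by rewrite -[x]psiK xE rmorphM rmorph_prod big_map.
Qed.

End Transfer.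

(** * Factoriality of [{mpoly k[n]}], adjoining one variable at a time *)

Section FactorialMpoly.
Variable k : fieldType.

(** The inverse of the isomorphism [muni], which singles out the last variable. *)
Definition mpoly_of_poly (n : nat) (p : {poly {mpoly k[n]}}) : {mpoly k[n.+1]} :=
  (map_poly (@mwiden n k) p).['X_ord_max].

HB.instance Definition _ n := GRing.RMorphism.copy (@mpoly_of_poly n)
  (horner_eval ('X_ord_max : {mpoly k[n.+1]}) \o map_poly (@mwiden n k)).

Lemma muni_mpolyX n (i : 'I_n.+1) : muni ('X_i : {mpoly k[n.+1]}) =
  if split (cast_ord (esym (addn1 n)) i) is inl j then ('X_j)%:P else 'X.
Proof. by rewrite /muni mmapX mmap1U. Qed.

Lemma muniK n : cancel (@muni n k) (@mpoly_of_poly n).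
Proof.
move=> p; elim/mpolyind: p => [|c m p _ _ IHp]; first by rewrite !rmorph0.
rewrite !rmorphD /= IHp -mul_mpolyC !rmorphM /= muniC; congr (_ * _ + _).
  by rewrite /mpoly_of_poly map_polyC hornerC /= mwidenC.
rewrite mpolyXE_id !rmorph_prod /=; apply: eq_bigr => i _.
rewrite !rmorphXn /= muni_mpolyX; congr (_ ^+ _).
case: splitP => [j|j] E; rewrite /mpoly_of_poly.
  rewrite map_polyC hornerC /= mwidenX mnmwiden1; congr 'X_ _.
  exact/val_inj/esym.
rewrite map_polyX hornerX; congr 'X_ _; apply/val_inj => /=.
by move: E; rewrite /= ord1 addn0.
Qed.

Lemma mpoly_of_polyK n : cancel (@mpoly_of_poly n) (@muni n k).
Proof.
have wid (c : {mpoly k[n]}) : muni (mwiden c) = c%:P.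
  elim/mpolyind: c => [|c m p _ _ IHp]; first by rewrite !rmorph0.
  rewrite !rmorphD /= IHp -mul_mpolyC !rmorphM /= mwidenC muniC; congr (_ * _ + _).
  rewrite mpolyXE_id !rmorph_prod /=; apply: eq_bigr => i _.
  rewrite !rmorphXn /= mwidenX mnmwiden1 muni_mpolyX; congr (_ ^+ _).
  case: splitP => [j E|j /eqP /=]; last first.
    by rewrite ord1 addn0 ltn_eqF.
  by congr (('X__)%:P); apply/val_inj.
move=> p; elim/poly_ind: p => [|p c IHp]; first by rewrite !rmorph0.
rewrite !rmorphD !rmorphM /= IHp; congr (_ * _ + _).
  rewrite /mpoly_of_poly map_polyX hornerX muni_mpolyX.
  by case: splitP => // j /= E; have := ltn_ord j; rewrite -E ltnn.
by rewrite /mpoly_of_poly map_polyC hornerC wid.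
Qed.

Lemma factorial_mpoly n : factorial_ring {mpoly k[n]}.
Proof.
elim: n => [|n IHn].
  move=> p p0; have pE : p = (p@_0%MM)%:MP.
    by apply/mpolyP => m; rewrite mcoeffC (_ : m = 0%MM) ?eqxx ?mulr1 //; apply/mnmP => -[].
  apply: factored_unit; exists ((p@_0%MM)^-1)%:MP.
  rewrite [X in _ = _ * X]pE -mpolyCM mulVf ?mpolyC1 //.
  by apply: contraNneq p0 => p0; rewrite pE p0 mpolyC0.
exact: (factorial_isomorphic (@mpoly_of_polyK n) (@muniK n) (factorial_poly IHn)).
Qed.

End FactorialMpoly.

(** * Derivatives and minors *)

Section Multiplicities.
Variables (k : fieldType) (N : nat).
Local Notation S := {mpoly k[N]}.

Lemma divides_mderiv_exp (q : S) e j : divides (q ^+ e.-1) (mderiv j (q ^+ e)).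
Proof.
case: e => [|e] /=; first by rewrite expr0; exact/divides_unit/divides_refl.
elim: e => [|e IHe]; first by rewrite expr0; exact/divides_unit/divides_refl.
rewrite [X in mderiv _ X]exprSr mderivM; apply: dividesD.
  by rewrite [X in divides X _]exprSr; apply: divides_mul IHe (divides_refl _).
exact/divides_mulr/divides_refl.
Qed.

Lemma divides_mderiv_prod (I : Type) (r : seq I) (q : I -> S) (e : I -> nat) j :
  divides (\prod_(i <- r) q i ^+ (e i).-1) (mderiv j (\prod_(i <- r) q i ^+ e i)).
Proof.
elim: r => [|i r IHr]; first by rewrite !big_nil; exact/divides_unit/divides_refl.
rewrite !big_cons mderivM; apply: dividesD; apply: divides_mul => //.
- exact: divides_mderiv_exp.
- by apply: divides_prod => l; case: (e l) => [|n] /=;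
    [exact: divides_refl|rewrite exprS; exact/divides_mull/divides_refl].
- by case: (e i) => [|n] /=;
    [exact: divides_refl|rewrite exprS; exact/divides_mull/divides_refl].
Qed.

Lemma mderiv_homog d j (p : S) : p \is d.-homog -> mderiv j p \is d.-1.-homog.
Proof.
move=> /dhomogP hp; apply/dhomogP => m; rewrite mcoeff_msupp mcoeff_deriv => pm.
have /hp <- : (m + U_(j))%MM \in msupp p.
  by rewrite mcoeff_msupp; apply: contraNneq pm => ->; rewrite mul0rn.
by rewrite /= mdegD mdeg1 addn1.
Qed.

Lemma prod_homog n d (E : 'I_n -> S) :
  (forall i, E i \is d.-homog) -> \prod_i E i \is (n * d).-homog.
Proof.
elim: n E => [|n IHn] E hE; first by rewrite big_ord0 dhomog1.
by rewrite big_ord_recl mulSn; apply: dhomogM => //; exact: IHn.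
Qed.

Lemma det_homog n d (A : 'M[S]_n) :
  (forall i j, A i j \is d.-homog) -> \det A \is (n * d).-homog.
Proof.
by move=> hA; apply: rpred_sum => s _; rewrite rpredMsign; exact: prod_homog.
Qed.

End Multiplicities.

Section Det3.
Variable R : comNzRingType.

Lemma det3E (M : 'M[R]_3)
    (i0 : 'I_3 := inord 0) (i1 : 'I_3 := inord 1) (i2 : 'I_3 := inord 2) :
  \det M = M i0 i0 * (M i1 i1 * M i2 i2 - M i1 i2 * M i2 i1)
         - M i0 i1 * (M i1 i0 * M i2 i2 - M i1 i2 * M i2 i0)
         + M i0 i2 * (M i1 i0 * M i2 i1 - M i1 i1 * M i2 i0).
Proof.
pose E (i j : nat) := M (inord i) (inord j).
have ME i j : M i j = E i j by rewrite /E !inord_val.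
rewrite (expand_det_row _ ord0) !big_ord_recl big_ord0 /cofactor.
rewrite !(expand_det_row _ ord0) !big_ord_recl !big_ord0 /cofactor !det_mx11 !mxE.
by rewrite !ME /= /bump /= !inordK //; move: E {ME} => E; ring.
Qed.

(* The matrix is a rank two matrix B = c u^T + x g w^T plus s x A; the cofactor *)
(* matrix of B is x (c * g) (u * w)^T, where * is the cross product.             *)
Lemma divides_det3 (M A : 'M[R]_3) (c g u w : 'I_3 -> R) (s x : R) :
  (forall i j, M i j = c i * u j + g i * (x * w j) + s * x * A i j) ->
  divides (s * x * x) (\det M).
Proof.
(* With indices taken modulo 3, the cofactors of a 3 x 3 matrix carry no signs. *)
move=> ME; pose o (i : nat) : 'I_3 := inord (i %% 3).
pose cross (v v' : 'I_3 -> R) (i : nat) : R :=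
  v (o i.+1) * v' (o i.+2) - v (o i.+2) * v' (o i.+1).
(* The terms of det (B + s x A) of degree 1, 2 and 3 in A, divided by [s * x * x]: cofactors of B
   against A, cofactors of A against B, and det A. The term det B vanishes, B having rank at most
   two. *)
exists (\sum_(i <- iota 0 3) \sum_(j <- iota 0 3)
  (cross c g i * cross u w j * A (o i) (o j)
    + s * (cross (A (o i.+1)) (A (o i.+2)) j
      * (c (o i) * u (o j) + g (o i) * (x * w (o j)))))
  + s * (s * x) * \det A).
rewrite !det3E !ME /= !big_cons !big_nil /cross /o /= -[(4 %% 3)%N]/1%N !modnn !modn_small //.
move: (c (inord 0)) (c (inord 1)) (c (inord 2)) => c0 c1 c2.
move: (g (inord 0)) (g (inord 1)) (g (inord 2)) => g0 g1 g2.
move: (u (inord 0)) (u (inord 1)) (u (inord 2)) => u0 u1 u2.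
move: (w (inord 0)) (w (inord 1)) (w (inord 2)) => w0 w1 w2.
ring.
Qed.
End Det3.

(** * Fibers *)

(** A duplicate-free list of maximal length, here one of least [gap], must be exhaustive. *)
Lemma finite_of_bounded (T : choiceType) (P : T -> Prop) (N : nat) :
  (forall s : seq T, uniq s -> (forall x, x \in s -> P x) -> (size s <= N)%N) ->
  exists Y : {fset T}, forall y, y \in Y <-> P y.
Proof.
move=> bound.
pose gap n := exists s : seq T, [/\ uniq s, forall x, x \in s -> P x & (N - size s = n)%N].
have [|n [s [us sP sn]] least] := @ex_least gap.
  by exists (N - 0)%N, [::].
exists [fset x in s]%fset => y; rewrite in_fset /=; split; first exact: sP.
move=> Py; apply/negPn/negP => yNs.
have us' : uniq (y :: s) by rewrite /= yNs.
have sP' x : x \in y :: s -> P x by rewrite inE => /orP[/eqP->|/sP].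
apply: (least (N - size (y :: s))%N); last by exists (y :: s).
by rewrite -sn ltn_sub2l //=; exact: (bound (y :: s)).
Qed.

(** * Primary components of maximal dimension *)

Section UnmixedPart.
Variables (k : closedFieldType) (N : nat).
Local Notation S := {mpoly k[N.+1]}.

(** Otherwise pick in each [Q i] an element outside [P]; their product lies in [J], hence in [P],
    against primality. *)
Lemma prime_contains_component (J P : S -> Prop) (s : nat) (Q : 'I_s -> S -> Prop) :
  is_primary_decomposition J Q -> is_prime_ideal P -> (forall p, J p -> P p) ->
  exists i, forall p, Q i p -> P p.
Proof.
move=> [Qprim JE _ _] [[P0 PD PM] PN1 Pprime] JP.
apply: NNPP => noi.
have /fin_all_exists[q qP] (i : 'I_s) : exists p, Q i p /\ ~ P p.
  apply: NNPP => nop; apply: noi; exists i => p Qp; apply: NNPP => Pp.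
  by apply: nop; exists p.
have : P (\prod_i q i).
  apply/JP/JE => i; rewrite (bigD1 i) //= mulrC.
  have [[[_ _ QM] _] _] := Qprim i.
  by apply: QM; exact: (qP i).1.
apply: (big_ind (fun x => ~ P x)) => //.
  by move=> x y Px Py /Pprime[].
by move=> i _; exact: (qP i).2.
Qed.

(** A maximal chain over [J] lies over a single component, which thus has dimension [r]. If [h] were
    a unit, this component would contain 1. *)
Lemma unmixed_part_nonunit (J : S -> Prop) r (h : S) :
  proj_dim J r -> defines_unmixed_part J r h -> ~ divides h 1.
Proof.
move=> [[P [Ppt Pchain]] Jmax] [_ [s [Q [Qdec hE]]]] h1.
have [Qprim JE _ _] := Qdec.
have [P0hom P0prime JP0 _] := Ppt ord0.
have [i QiP0] := prime_contains_component Qdec P0prime JP0.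
have QiP j p : Q i p -> P j p.
  move=> /QiP0; case: (posnP j) => [j0|j0]; last by apply: (Pchain ord0 j j0).1.
  by rewrite (_ : j = ord0) //; exact: val_inj.
have Qdim : proj_dim (Q i) r.
  split.
    exists P; split=> // j; have [Phom Pprime _ PX] := Ppt j.
    by split=> // p; exact: QiP.
  move=> t [P' [P'pt P'chain]]; apply: Jmax; exists P'; split=> // j.
  have [Phom Pprime QP PX] := P'pt j; split=> // p /JE Jp.
  exact: QP.
have [_ [_ QN1 _]] := Qprim i.
by apply: QN1; move/hE: h1; apply.
Qed.

End UnmixedPart.

Section Fibers.
Variables (k : closedFieldType) (m n : nat).
Local Notation R := {mpoly k[m.+1]}.
Variable f : 'I_n.+1 -> R.
Implicit Type y : pspace k n.

Lemma pspace_line y : val y = <[vpick (val y)]>%VS.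
Proof.
apply/eqP; rewrite eq_sym eqEdim -memvE memv_pick dim_vline vpick0.
by rewrite -dimv_eq0 (eqP (valP y)).
Qed.

Lemma hcoord_neq0 y : exists i, hcoord y i != 0.
Proof.
apply: NNPP => H; have /eqP := valP y.
have -> : val y = 0%VS.
  apply/eqP; rewrite -vpick0; apply/eqP/rowP => i; rewrite mxE.
  by apply/eqP/negPn/negP => yi; apply: H; exists i.
by rewrite dimv0.
Qed.

Lemma hcoord_inj y y' i : hcoord y i != 0 ->
  (forall j, hcoord y' i * hcoord y j = hcoord y' j * hcoord y i) -> y = y'.
Proof.
move=> yi E; apply: val_inj.
have y'E : vpick (val y') = (hcoord y' i / hcoord y i) *: vpick (val y).
  apply/rowP => j; rewrite mxE; apply: (mulIf yi).
  by rewrite mulrAC divfK // E.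
apply/eqP; rewrite eq_sym eqEdim (eqP (valP y)) (eqP (valP y')) leqnn andbT.
by rewrite (pspace_line y') y'E -memvE memvZ // memv_pick.
Qed.

(** Specialization of the Koszul relation [T_a f_b - T_b f_a], which vanishes under
    [T_i |-> f_i t]. *)
Lemma fiber_ideal_syzygy y a b :
  fiber_ideal f y ((hcoord y a)%:MP * f b - (hcoord y b)%:MP * f a).
Proof.
exists (('X_a : {mpoly R[n.+1]}) * (f b)%:MP - 'X_b * (f a)%:MP).
  rewrite /rees_ideal rmorphB !rmorphM /= !mmapC !mmapX !mmap1U.
  by rewrite mulrAC [X in _ - X]mulrAC [(f b)%:P * _]mulrC subrr.
by rewrite mevalB !mevalM !mevalXU !mevalC.
Qed.

(** Modulo [p], the vector f is proportional to the coordinates of [y]. Unlike the property of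
    defining the unmixed part, this passes to the prime factors of [h_y]. *)
Definition fiber_divisor y (p : R) : Prop :=
  forall a b, divides p ((hcoord y a)%:MP * f b - (hcoord y b)%:MP * f a).

Lemma unmixed_part_divisor y r h :
  defines_unmixed_part (fiber_ideal f y) r h -> fiber_divisor y h.
Proof.
move=> [_ [s [Q [[_ JE _ _] hE]]]] a b; apply/hE => i _.
exact: (JE _).1 (fiber_ideal_syzygy y a b) i.
Qed.

Lemma fiber_divisor_congr y p : fiber_divisor y p -> exists a c,
  [/\ hcoord y a != 0, forall i, c i = hcoord y i / hcoord y a
    & forall i, divides p (f i - (c i)%:MP * f a)].
Proof.
move=> yp; have [a ya] := hcoord_neq0 y.
exists a, (fun i => hcoord y i / hcoord y a); split=> // i.
have /(divides_mull (hcoord y a)^-1%:MP) := yp a i.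
by rewrite mulrBr !mulrA -!mpolyCM mulVf // mpolyC1 mul1r [_^-1 * _]mulrC.
Qed.

(** Modulo [p], the vector f is proportional to two linearly independent constant vectors, so it
    vanishes. *)
Lemma fiber_divisor_common y y' p : prime_elt p -> y != y' ->
  fiber_divisor y p -> fiber_divisor y' p -> forall i, divides p (f i).
Proof.
move=> [p0 pN1 pM] yy' yp y'p.
have [a [c [ya cE cP]]] := fiber_divisor_congr yp.
suff pfa : divides p (f a).
  move=> i; rewrite -[f i](subrK ((c i)%:MP * f a)); apply: dividesD => //.
  exact: divides_mull.
have [b yb] : exists b, hcoord y' a * hcoord y b != hcoord y' b * hcoord y a.
  apply: NNPP => H; move/eqP: yy'; apply; apply: hcoord_inj ya _ => j.
  by apply/eqP/negPn/negP => Hj; apply: H; exists j.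
(* This scalar is a nonzero 2 x 2 minor of the coordinates of [y] and [y'], divided by the
   coordinate [a] of [y]. *)
have ub : hcoord y' a * c b - hcoord y' b != 0.
  apply: contraNneq yb => /eqP; rewrite subr_eq0 => /eqP <-.
  by rewrite cE mulrA divfK.
have : divides p ((hcoord y' a * c b - hcoord y' b)%:MP * f a).
  have -> : (hcoord y' a * c b - hcoord y' b)%:MP * f a =
      ((hcoord y' a)%:MP * f b - (hcoord y' b)%:MP * f a)
      - (hcoord y' a)%:MP * (f b - (c b)%:MP * f a).
    by rewrite mpolyCB mpolyCM; ring.
  by apply: dividesD; [|exact/dividesN/divides_mull].
move=> /(divides_mull (hcoord y' a * c b - hcoord y' b)^-1%:MP).
by rewrite mulrA -mpolyCM mulVf // mpolyC1 mul1r.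
Qed.

(** Write [h = s z], [f_i = c_i f_l + g_i h] and [z w_j] for the derivatives of [h]. Differentiating
    gives [c_i (f_l)_j + g_i z w_j + s z (g_i)_j], the shape required by [divides_det3]. *)
Lemma fiber_divisor_minor y r (q : 'I_r -> R) (e : 'I_r -> nat) x :
  (forall i, (1 <= e i)%N) -> fiber_divisor y (\prod_i q i ^+ e i) ->
  is_minor 3 (jacobian f) x -> divides (\prod_i q i ^+ (2 * e i - 1)) x.
Proof.
move=> e1 yh [a [b [_ _ ->]]].
have [l [c [_ _ cP]]] := fiber_divisor_congr yh.
have /fin_all_exists[g gE] (i : 'I_n.+1) := cP i.
pose s := \prod_i q i; pose z := \prod_i q i ^+ (e i).-1.
have hE : \prod_i q i ^+ e i = s * z.
  by rewrite -big_split /=; apply: eq_bigr => i _; rewrite -exprS prednK.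
have -> : \prod_i q i ^+ (2 * e i - 1) = s * z * z.
  rewrite -hE -big_split; apply: eq_bigr => i _ /=; rewrite -exprD; congr (_ ^+ _).
  by case: (e i) (e1 i) => // t _; rewrite mul2n -addnn addnS subn1.
have /fin_all_exists[w wE] (j : 'I_m.+1) :=
  divides_mderiv_prod (index_enum 'I_r) q e j.
apply: (@divides_det3 _ _ (\matrix_(i, j) mderiv (b j) (g (a i)))
  (fun i => (c (a i))%:MP) (fun i => g (a i)) (fun j => mderiv (b j) (f l))
  (fun j => w (b j))) => i j.
have fE : f (a i) = (c (a i))%:MP * f l + g (a i) * (s * z).
  by rewrite -hE -gE addrC subrK.
rewrite !mxE {1}fE mderivD mderiv_mulC mderivM -hE wE -/z hE.
by ring.
Qed.

End Fibers.

(** * Degrees of products and divisors *)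

Section Degrees.
Variables (k : closedFieldType) (N : nat).
Local Notation S := {mpoly k[N.+1]}.

Lemma pdegM (p q : S) : p != 0 -> q != 0 -> pdeg (p * q) = (pdeg p + pdeg q)%N.
Proof.
move=> p0 q0; rewrite /pdeg msizeM // (mpolySpred _ p0) (mpolySpred _ q0) /=.
by rewrite addnS.
Qed.

Lemma pdeg1 : pdeg (1 : S) = 0%N.
Proof. by rewrite /pdeg msize1. Qed.

Lemma pdeg_prod (I : eqType) (r : seq I) (E : I -> S) :
  (forall i, i \in r -> E i != 0) -> pdeg (\prod_(i <- r) E i) = (\sum_(i <- r) pdeg (E i))%N.
Proof.
move=> E0; suff [-> _] : pdeg (\prod_(i <- r) E i) = (\sum_(i <- r) pdeg (E i))%N /\
    \prod_(i <- r) E i != 0 by [].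
rewrite !big_seq; elim/big_rec2: _ => [|i n p ir [pE p0]].
  by rewrite pdeg1 oner_neq0.
by rewrite pdegM ?pE ?mulf_neq0 ?E0.
Qed.

Lemma pdegX (p : S) n : p != 0 -> pdeg (p ^+ n) = (n * pdeg p)%N.
Proof.
move=> p0; elim: n => [|n IHn]; first by rewrite expr0 pdeg1.
by rewrite exprS pdegM ?expf_neq0 // IHn mulSn.
Qed.

Lemma pdeg_prodX r (q : 'I_r -> S) (e : 'I_r -> nat) : (forall i, q i != 0) ->
  pdeg (\prod_i q i ^+ e i) = (\sum_i e i * pdeg (q i))%N.
Proof.
move=> q0; rewrite pdeg_prod => [|i _]; last exact: expf_neq0.
by apply: eq_bigr => i _; rewrite pdegX.
Qed.

Lemma divides_pdeg (p q : S) : q != 0 -> divides p q -> (pdeg p <= pdeg q)%N.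
Proof.
move=> q0 [a qE]; move: q0; rewrite qE mulf_eq0 negb_or => /andP[a0 p0].
by rewrite pdegM // leq_addl.
Qed.

Lemma pdeg_eq0_unit (p : S) : p != 0 -> pdeg p = 0%N -> divides p 1.
Proof.
move=> p0 degp; have pE : p = (p@_0%MM)%:MP.
  by apply: msize1_polyC; rewrite (mpolySpred _ p0) -/(pdeg p) degp.
exists ((p@_0%MM)^-1)%:MP; rewrite [X in _ = _ * X]pE -mpolyCM mulVf ?mpolyC1 //.
by apply: contraNneq p0 => c0; rewrite pE c0 mpolyC0.
Qed.

Lemma pdeg_homog d (p : S) : p != 0 -> p \is d.-homog -> pdeg p = d.
Proof. by move=> p0 hp; exact: dhomog_uniq p0 (dhomog_msize hp) hp. Qed.

End Degrees.

Theorem theorem3p5 (k : closedFieldType) (m n d : nat)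
    (hm : (2 <= m)%N) (hn : (1 <= n)%N)
    (f : 'I_n.+1 -> {mpoly k[m.+1]})
    (f_homog : forall i, f i \is d.-homog)
    (f_min : minimal_generators f)
    (f_gcd : is_gcd (fun p => exists i, p = f i) 1)
    (f_fin : generically_finite f)
    (I3_neq0 : exists2 p, minors_ideal 3 (jacobian f) p & p != 0)
    (F : {mpoly k[m.+1]})
    (hF : is_gcd (is_minor 3 (jacobian f)) F)
    (h : pspace k n -> {mpoly k[m.+1]})
    (h_def : forall y, in_Y f y ->
       defines_unmixed_part (fiber_ideal f y) m.-1 (h y))
    (r : pspace k n -> nat)
    (hi : forall y, 'I_(r y) -> {mpoly k[m.+1]})
    (e : forall y, 'I_(r y) -> nat)
    (h_fact : forall y, in_Y f y ->
       is_factorization (h y) (@hi y) (@e y)) :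
  exists2 Y : {fset pspace k n}, (forall y, y \in Y <-> in_Y f y) &
    [/\ (\sum_(y <- Y) pdeg (h y)
           <= \sum_(y <- Y) \sum_(i < r y) (2 * e y i - 1) * pdeg (hi y i))%N,
        (\sum_(y <- Y) \sum_(i < r y) (2 * e y i - 1) * pdeg (hi y i)
           <= pdeg F)%N
      & (pdeg F <= 3 * (d - 1))%N].
Proof.
(* A nonzero ideal has a nonzero generator; this minor bounds deg F and shows that F is nonzero. *)
have [x xminor x0] : exists2 x, is_minor 3 (jacobian f) x & x != 0.
  apply: NNPP => nominor; have [p [s sP ->]] := I3_neq0.
  rewrite big_seq big1 ?eqxx // => c /sP cminor.
  suff -> : c.2 = 0 by rewrite mulr0.
  by apply/eqP/negPn/negP => c0; apply: nominor; exists c.2.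
have Fx : divides F x by exact: hF.1.
have F0 : F != 0.
  by apply: contraNneq x0 => F0; have [a ->] := Fx; rewrite F0 mulr0.
have degx : pdeg x = (3 * (d - 1))%N.
  apply: pdeg_homog x0 _; have [a [b [_ _ ->]]] := xminor.
  by apply: det_homog => i j; rewrite !mxE subn1; exact: mderiv_homog.
pose D y := \prod_i hi y i ^+ (2 * e y i - 1).
have hi0 y : in_Y f y -> forall i, hi y i != 0.
  by move=> /h_fact[irr _ _ _] i; case: (irr i).
have D0 y : in_Y f y -> D y != 0.
  by move=> yY; apply/prodf_neq0 => i _; rewrite expf_neq0 ?hi0.
have degD y : in_Y f y -> pdeg (D y) = (\sum_i (2 * e y i - 1) * pdeg (hi y i))%N.
  by move=> yY; rewrite /D pdeg_prodX //; exact: hi0.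
have degh y : in_Y f y -> (pdeg (h y) <= pdeg (D y))%N.
  move=> yY; have [_ _ e1 ->] := h_fact y yY.
  rewrite degD // pdeg_prodX; last exact: hi0.
  apply: leq_sum => i _; rewrite leq_mul2r; apply/orP; right.
  by case: (e y i) (e1 i) => // t _; rewrite mul2n -addnn addnS subn1 leq_addr.
have degh_gt0 y : in_Y f y -> (0 < pdeg (h y))%N.
  move=> yY; rewrite lt0n; apply/eqP => degh0.
  apply: (unmixed_part_nonunit yY (h_def y yY)).
  apply: pdeg_eq0_unit degh0; have [_ _ _ ->] := h_fact y yY.
  by apply/prodf_neq0 => i _; rewrite expf_neq0 ?hi0.
have divisor_h y : in_Y f y -> fiber_divisor f y (h y).
  by move=> yY; exact: unmixed_part_divisor (h_def y yY).
have prime_h y p : in_Y f y -> prime_elt p -> divides p (D y) -> fiber_divisor f y p.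
  move=> yY pP /(prime_divides_bigprod pP)[i /(prime_divides_exp pP) pi] a b.
  apply: divides_trans (divisor_h y yY a b).
  apply: divides_trans pi _; have [_ _ e1 ->] := h_fact y yY.
  rewrite (bigD1 i) //=; apply: divides_mulr.
  by rewrite -(prednK (e1 i)) exprS; exact/divides_mulr/divides_refl.
(* A common prime would divide every [f_i], hence their gcd 1. *)
have coprime_D y y' : in_Y f y -> in_Y f y' -> y != y' -> coprime_elt (D y) (D y').
  move=> yY yY' yy' p pP py py'; have [_ pN1 _] := pP; apply: pN1.
  apply: f_gcd.2 => _ [i ->].
  exact: fiber_divisor_common pP yy' (prime_h _ _ yY pP py) (prime_h _ _ yY' pP py') i.
(* Stated for arbitrary finite lists, as it serves twice: to prove that Y is finite, and then as the
   middle inequality. *)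
have bound (s : seq (pspace k n)) : uniq s -> (forall y, y \in s -> in_Y f y) ->
    (\sum_(y <- s) pdeg (D y) <= pdeg F)%N.
  move=> us sY; rewrite -pdeg_prod => [|y /sY]; last exact: D0.
  apply: divides_pdeg F0 _; apply: hF.2 => z zminor.
  apply: coprime_prod_divides => // [|y /sY/D0 //|y y' /sY yY /sY yY'|y /sY yY].
  - exact: factorial_mpoly.
  - exact: coprime_D.
  - have [_ _ e1 hE] := h_fact y yY; apply: fiber_divisor_minor zminor => //.
    by rewrite -hE; exact: divisor_h.
have [|Y YE] := @finite_of_bounded _ (in_Y f) (pdeg F).
  move=> s us sY; apply: leq_trans (bound s us sY).
  rewrite -sum1_size big_seq [X in (_ <= X)%N]big_seq.
  apply: leq_sum => y /sY yY.
  exact: leq_trans (degh_gt0 y yY) (degh y yY).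
exists Y => //; have YP y : y \in enum_fset Y -> in_Y f y by move=> yY; apply/YE.
have sumE : (\sum_(y <- Y) \sum_(i < r y) (2 * e y i - 1) * pdeg (hi y i)
    = \sum_(y <- Y) pdeg (D y))%N.
  by rewrite big_seq [RHS]big_seq; apply: eq_bigr => y /YP/degD ->.
split; rewrite ?sumE.
- rewrite big_seq [X in (_ <= X)%N]big_seq; apply: leq_sum => y /YP; exact: degh.
- exact: bound (fset_uniq Y) YP.
- by rewrite -degx; exact: divides_pdeg.
Qed.
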